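(* Let $G$ be a unicyclic graph whose only cycle $C^*$ has length $k$ and whose set of pendant vertices is $L(G)$, with $|L(G)|=l$. Let $V^+_{c^*}$ be the set of vertices of $C^*$ with degree at least $3$ in $G$. If $G'$ is obtained from $G$ by removing an edge $e=uv$ of $C^*$, then $$meg(G')=\begin{cases} l, & \text{if } u,v\in V^+_{c^*},\\ l+1, & \text{if exactly one of } u,v \text{ belongs to } V^+_{c^*},\\ l+2, & \text{if } u,v\notin V^+_{c^*}.\end{cases}$$
   Context: Graphs are finite, undirected and simple; a unicyclic graph is a connected graph containing exactly one cycle; a pendant vertex is a vertex of degree $1$. In a connected graph $H$, an edge $e$ is monitored by a pair of vertices $x,y$ if $e$ lies on all shortest paths between $x$ and $y$. A set $M\subseteq V(H)$ is a monitoring edge-geodetic set (MEG-set) of $H$ if every edge of $H$ is monitored by some pair of vertices of $M$; $meg(H)$ is the minimum size of a MEG-set of $H$. *)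

(* Defs.v *)
From mathcomp Require Import all_boot.
From mathcomp Require Import boolp.

Set Implicit Arguments.
Unset Strict Implicit.
Unset Printing Implicit Defensive.

Record sgraph := SGraph {
  vertex :> finType;
  adj : rel vertex;
  adj_sym : symmetric adj;
  adj_irr : irreflexive adj
}.

Section Graph.
Variable G : sgraph.
Implicit Types (x y : G) (p c : seq G) (E : {set G}) (M : {set G}).

Definition deg x : nat := #|[set y | adj x y]|.

Definition pendants : {set G} := [set x | deg x == 1].

(* Edges are unordered pairs, represented as two-element sets. *)
Definition edges : {set {set G}} :=
  [set [set z.1; z.2] | z : G * G & adj z.1 z.2].

Definition connected : Prop := forall x y, connect (@adj G) x y.

Definition is_cycle c : bool := [&& 2 < size c, uniq c & cycle (@adj G) c].

Definition cycle_edges c : {set {set G}} := [set [set x; next c x] | x in c].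

(* The sequences representing one cycle, up to rotation and reversal, are
   those with the same edge set; the vertex set alone would not do, as in K4. *)
Definition unicyclic : Prop :=
  connected /\
  exists c, is_cycle c /\
    forall c', is_cycle c' -> cycle_edges c' = cycle_edges c.

(* As in path.v, the vertex sequence of the path is x :: p. *)
Definition path_between x y p : bool :=
  [&& path (@adj G) x p, uniq (x :: p) & last x p == y].

Definition shortest_path x y p : Prop :=
  path_between x y p /\ forall q, path_between x y q -> size p <= size q.

Definition path_edges x p : seq {set G} :=
  [seq [set z.1; z.2] | z <- zip (x :: p) p].

(* Intended for connected graphs, where a shortest path always exists. *)
Definition monitors x y E : Prop :=
  forall p, shortest_path x y p -> E \in path_edges x p.

Definition meg_set M : Prop :=
  forall E, E \in edges ->
    exists x y, [/\ x \in M, y \in M & monitors x y E].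

Lemma meg_setT : meg_set [set: G].
Proof.
move=> E /imsetP[[x y]]; rewrite inE /= => axy ->.
exists x, y; split=> // p [/and3P[_ _ /eqP lp] minp].
have xNy : x != y by apply/eqP=> exy; move: axy; rewrite exy adj_irr.
have: size p <= size [:: y].
  by apply: minp; rewrite /path_between /= axy inE xNy eqxx.
case: p lp {minp} => [exy|z [|//] /= -> _]; first by rewrite -exy eqxx in xNy.
by rewrite /path_edges /= inE.
Qed.

(* By meg_setT, the default value of the minimum is itself an MEG-set. *)
Definition meg : nat :=
  #|[arg min_(M < [set: G] | `[< meg_set M >]) #|M|]|.

End Graph.

Section DeleteEdge.
Variables (G : sgraph) (E : {set G}).

Definition del_edge_adj : rel G := fun x y => adj x y && ([set x; y] != E).

Lemma del_edge_sym : symmetric del_edge_adj.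
Proof. by move=> x y; rewrite /del_edge_adj adj_sym setUC. Qed.

Lemma del_edge_irr : irreflexive del_edge_adj.
Proof. by move=> x; rewrite /del_edge_adj adj_irr. Qed.

Definition del_edge : sgraph := SGraph del_edge_sym del_edge_irr.

End DeleteEdge.

Definition cycle_branch (G : sgraph) (c : seq G) : {set G} :=
  [set x in c | 3 <= deg x].

(* Main.v *)
(** Deleting an edge of the unique cycle leaves a tree, and the minimum MEG-set
    of a tree [H] is its set of leaves. A leaf lies in every MEG-set because it
    cannot be an interior vertex of a path through its only edge. Conversely,
    growing a path from an edge [xy] on either side ends in leaves [a] and [b];
    as [xy] is a bridge, it lies on every path from [a] to [b]. The leaves of
    the tree are the pendant vertices of [G] together with those of [u], [v]
    that have degree 2 in [G]. *)
Require Import Defs.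
From mathcomp Require Import all_boot.
From mathcomp Require Import boolp.

Set Implicit Arguments.
Unset Strict Implicit.
Unset Printing Implicit Defensive.

Definition acyclic (H : sgraph) : Prop := forall c : seq H, ~~ is_cycle c.

Lemma set2_neq (T : finType) (x y z w : T) :
  z != x -> w != x -> [set z; w] != [set x; y].
Proof.
move=> zx wx; apply/eqP => /setP/(_ x); rewrite !inE eqxx /=.
by rewrite eq_sym (negPf zx) eq_sym (negPf wx).
Qed.

Lemma connect_adj_sym (H : sgraph) : connect_sym (@adj H).
Proof. exact/sym_connect_sym/adj_sym. Qed.

Section Forest.
Variable H : sgraph.
Implicit Types (x y z : H) (p s : seq H).

Lemma pendantP x : reflect (exists y, forall z, adj x z = (z == y))
  (x \in pendants H).
Proof.
rewrite inE /deg; apply: (iffP cards1P) => -[y xy]; exists y.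
  by move=> z; have /setP/(_ z) := xy; rewrite !inE.
by apply/setP=> z; rewrite !inE xy.
Qed.

Lemma path_del_edge x y z s : path (@adj H) z s -> x \notin z :: s ->
  path (@adj (del_edge [set x; y])) z s.
Proof.
move=> zs xNzs; apply: (@sub_in_path _ (predC1 x) (@adj H)) zs => [a b|].
  by rewrite !inE /= /del_edge_adj => ax bx ->; rewrite set2_neq.
by apply/allP => w; apply: contraTneq => ->.
Qed.

Lemma path_edges_sub x a p (E : {set H}) :
  E \in path_edges a p -> x \in E -> x \in a :: p.
Proof.
rewrite /path_edges => /mapP[[z w] zw ->] /=; rewrite !inE.
elim: p a zw => [|b p IHp] a //=; rewrite inE => /orP[/eqP[-> ->]|].
  by rewrite !inE => /orP[->|->]; rewrite ?orbT.
by move=> /IHp IH /IH; rewrite !inE => ->; rewrite orbT.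
Qed.

Lemma path_del_edge_edges a p (E : {set H}) : path (@adj H) a p ->
  E \notin path_edges a p -> path (@adj (del_edge E)) a p.
Proof.
elim: p a => [|b p IHp] a //= /andP[ab bp].
rewrite /path_edges /= inE negb_or => /andP[abE /IHp ->] //.
by rewrite /del_edge_adj ab eq_sym abE.
Qed.

(** At an interior occurrence of [x], the vertices just before and just after it would both be its
    only neighbour [y], so the path would repeat [y]. *)
Lemma pendant_endpoint x a p : x \in pendants H -> path (@adj H) a p ->
  uniq (a :: p) -> x \in a :: p -> x = a \/ x = last a p.
Proof.
move=> /pendantP[y xy] + + /predU1P[|xp]; first by left.
case/splitPr: xp => p1 [|b p2]; first by right; rewrite last_cat.
rewrite cat_path [path _ _ (_ :: _)]/= adj_sym !xy.
move=> /and4P[_ /eqP ay /eqP -> _].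
rewrite -cat_cons cat_uniq => /and3P[_ /hasPn/(_ y)].
by rewrite !inE eqxx orbT -ay -in_cons mem_last => /(_ isT).
Qed.

Lemma pendants_sub_meg (M : {set H}) : connected H -> meg_set M ->
  pendants H \subset M.
Proof.
move=> conH megM; apply/subsetP=> x xP; have /pendantP[y xy] := xP.
have [|a [b [aM bM mon]]] := megM [set x; y].
  by apply/imsetP; exists (x, y); rewrite // inE /= xy.
(* [monitors] is vacuous without a shortest path, so connectedness has to supply one. *)
have exP : exists n, `[< exists p, path_between a b p /\ size p = n >].
  have /connectP[p ap ->] := conH a b; case/shortenP: ap => q aq uq _.
  exists (size q); apply/asboolP; exists q; split=> //.
  by rewrite /path_between aq uq eqxx.
case: (ex_minnP exP) => n /asboolP[p [abp <-]] minp.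
have /mon/path_edges_sub/(_ (set21 _ _)) xp : shortest_path a b p.
  by split=> // q abq; apply: minp; apply/asboolP; exists q.
have /and3P[ap up /eqP lp] := abp.
by have [->|->] := pendant_endpoint xP ap up xp; rewrite ?lp.
Qed.

Hypothesis H_acyclic : acyclic H.

Lemma acyclic_bridge x y : adj x y ->
  ~~ connect (@adj (del_edge [set x; y])) x y.
Proof.
move=> xy; apply/negP => /connectP[p xp].
case/shortenP: xp => q xq uq _ yq; have /negP := H_acyclic (x :: q); apply.
have sq : subrel (@adj (del_edge [set x; y])) (@adj H) by move=> a b /andP[].
rewrite /is_cycle uq [cycle _ _]/= rcons_path (sub_path sq xq) -yq adj_sym xy.
(* The closed walk has at least three vertices: an empty [q] gives [x = y], and a single step would
   be the removed edge itself. *)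
case: q xq uq yq => [|z [|//]] /=.
  by move=> _ _ yx; rewrite yx adj_irr in xy.
by move=> + _ yz; rewrite -yz /del_edge_adj eqxx andbF.
Qed.

Lemma acyclic_pendant x y : adj x y -> exists2 a, a \in pendants H &
  connect (@adj (del_edge [set x; y])) x a.
Proof.
move=> xy; pose e := @adj (del_edge [set x; y]).
have [n] : exists n, #|H| <= n + size [:: y] by exists #|H|; exact: leq_addr.
have : path (@adj H) x [:: y] by rewrite /= xy.
have : uniq [:: x; y].
  by rewrite /= inE andbT; apply: contraTneq xy => ->; rewrite adj_irr.
have : y \in [:: y] by rewrite inE.
have : connect e x x by [].
(* Invariant: [z :: s] is a simple path listed from its growing end [z], with [y] in its tail and
   [z] reachable from [x] without the edge [xy]; [n] bounds the extensions still possible. *)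
move: {3 4 5}x [:: y] => z s.
elim: n z s => [|n IHn] z [|z' s] // xz ys uzs zs sz.
  have := leq_trans (max_card (mem (z :: z' :: s))) sz.
  by rewrite (card_uniqP uzs) ltnn.
have zz' : adj z z' by case/andP: zs.
have [w /andP[zw wz']|noW] := pickP [pred w | adj z w && (w != z')]; last first.
  exists z => //; apply/pendantP; exists z' => w; have /= := noW w.
  by case: eqP => [->|_]; rewrite ?zz' // andbT.
(* If [w] were already on the path, the segment from [z] to [w] and the edge [zw] would form a
   cycle, of length at least 3 because [w] is not [z']. *)
have wNzs : w \notin z :: z' :: s.
  rewrite !inE (negPf wz') /= negb_or; apply/andP; split.
    by apply: contraTneq zw => ->; rewrite adj_irr.
  apply/negP=> ws; case/splitPr: ws zs uzs {ys sz} => s1 s2 zs uzs.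
  have /negP := H_acyclic (z :: z' :: rcons s1 w); apply.
  move: zs uzs; rewrite -cat_rcons -!cat_cons cat_uniq => + /andP[uz1 _].
  rewrite cat_path /is_cycle uz1 /= size_rcons => /andP[/andP[_ zw1] _].
  by rewrite zz' rcons_path zw1 last_rcons adj_sym.
(* Neither [z] nor [w] is [y], so the new edge [zw] is not the removed one. *)
have yz : y != z by apply: contraTneq ys => ->; case/andP: uzs.
have yw : w != y by apply: contraNneq wNzs => ->; rewrite inE ys orbT.
apply: (IHn w (z :: z' :: s)).
- apply: connect_trans xz (connect1 _).
  rewrite /e /= /del_edge_adj zw setUC /= [[set x; y]]setUC.
  by rewrite set2_neq // eq_sym.
- by rewrite inE ys orbT.
- by rewrite cons_uniq wNzs.
- by rewrite /= adj_sym zw.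
- by rewrite [size _]/= addnS -addSn.
Qed.

Lemma meg_acyclic : connected H -> meg H = #|pendants H|.
Proof.
move=> conH; rewrite /meg.
have megP : meg_set (pendants H).
  move=> E /imsetP[[x y]]; rewrite inE /= => xy ->.
  have [a aP xa] := acyclic_pendant xy.
  have [b bP yb] : exists2 b, b \in pendants H &
    connect (@adj (del_edge [set x; y])) y b.
    by rewrite setUC; apply: acyclic_pendant; rewrite adj_sym.
  exists a, b; split=> // p [/and3P[ap _ /eqP lp] _].
  (* If [p] missed the edge, then [x] to [a], [p], and [b] to [y] would join [x] to [y] without
     it. *)
  apply: contraT => /(path_del_edge_edges ap) ap'.
  have /negP := acyclic_bridge xy; case.
  have sym := @connect_adj_sym (del_edge [set x; y]).
  apply: connect_trans xa _; rewrite sym; apply: connect_trans yb _.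
  by rewrite sym; apply/connectP; exists p.
case: arg_minnP => [|M /asboolP megM minM].
  by apply/asboolP; exact: meg_setT.
apply/eqP; rewrite eqn_leq minM /=; last exact/asboolP.
exact/subset_leq_card/pendants_sub_meg.
Qed.

End Forest.

(** The rest of the cycle, followed onward from [next c x], leads back to [x]. Its last edge differs
    from the removed one because a cycle has at least three vertices. *)
Lemma next_edge_connect (G : sgraph) (c : seq G) (x : G) :
  is_cycle c -> x \in c ->
  connect (@adj (del_edge [set x; next c x])) x (next c x).
Proof.
move=> /and3P[+ uc +] xc; have [i s cE] := rot_to xc.
rewrite -(next_rot i uc) -(size_rot i) -(rot_cycle i) cE.
have {cE uc}: uniq (x :: s) by rewrite -cE rot_uniq.
case: s => [|y s] //= /and3P[xNys yNs _]; rewrite eqxx.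
rewrite !ltnS => s_gt0 /andP[_]; rewrite rcons_path => /andP[ys sx].
rewrite (@connect_adj_sym (del_edge _)); apply/connectP; exists (rcons s x).
  rewrite rcons_path (path_del_edge _ ys xNys) /= /del_edge_adj sx /=.
  case/lastP: s s_gt0 yNs xNys {ys sx} => // s z _.
  rewrite last_rcons !inE !mem_rcons !inE !negb_or.
  move=> /andP[yz _] /and3P[xy xz _].
  by rewrite setUC [[set x; y]]setUC set2_neq // eq_sym.
by rewrite last_rcons.
Qed.

Section DeleteCycleEdge.
Variables (G : sgraph) (c : seq G) (u v : G).
Hypotheses (c_cycle : is_cycle c) (uv_in_c : [set u; v] \in cycle_edges c).
Local Notation G' := (del_edge [set u; v]).

(** An unordered edge forgets the direction in which [next] traverses it, hence two cases. *)
Lemma cycle_edgeP : (u \in c /\ next c u = v) \/ (v \in c /\ next c v = u).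
Proof.
have /imsetP[x xc uvE] := uv_in_c; have /and3P[_ _ cc] := c_cycle.
have xNx : x != next c x.
  by apply: contraTneq (next_cycle cc xc) => <-; rewrite adj_irr.
have uNv : u != v by have := cards2 u v; rewrite uvE cards2 xNx; case: eqP.
have := set22 u v; have := set21 u v; rewrite uvE !inE.
by move=> /orP[]/eqP uE /orP[]/eqP vE; move: uNv; rewrite uE vE ?eqxx; auto.
Qed.

Lemma cycle_edge_mem : u \in c /\ v \in c.
Proof. by case: cycle_edgeP => -[wc <-]; rewrite mem_next. Qed.

Lemma cycle_edge_adj : adj u v.
Proof.
have /and3P[_ _ cc] := c_cycle.
by case: cycle_edgeP => -[wc <-]; last rewrite adj_sym; apply: next_cycle.
Qed.

Lemma del_cycle_edge_connect : connect (@adj G') u v.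
Proof.
case: cycle_edgeP => -[wc <-]; first exact: next_edge_connect.
by rewrite setUC (@connect_adj_sym (del_edge _)); exact: next_edge_connect.
Qed.

(** Every use of the deleted edge can be replaced by the detour around the cycle. *)
Lemma del_cycle_edge_connected : connected G -> connected G'.
Proof.
move=> conG x y; apply: connect_sub (conG x y) => {x y} x y xy.
have [xyE|xyNE] := eqVneq [set x; y] [set u; v]; last first.
  by apply: connect1; rewrite /= /del_edge_adj xy xyNE.
have uv := del_cycle_edge_connect.
have vu : connect (@adj G') v u by rewrite (@connect_adj_sym (del_edge _)).
have : (x \in [set u; v]) && (y \in [set u; v]) by rewrite -xyE set21 set22.
by rewrite !inE => /andP[/orP[]/eqP-> /orP[]/eqP->].
Qed.

(** A cycle surviving the deletion would also be a cycle of [G], so it would have the edges of [c],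
    among them the deleted one. *)
Lemma del_cycle_edge_acyclic :
  (forall c', is_cycle c' -> cycle_edges c' = cycle_edges c) -> acyclic G'.
Proof.
move=> c_only c'; apply/negP => /and3P[c'_gt2 uc' cc'].
have c'_cycle : @is_cycle G c'.
  by rewrite /is_cycle c'_gt2 uc'; apply: sub_cycle cc' => x y /andP[].
have := uv_in_c; rewrite -(c_only c' c'_cycle) => /imsetP[x xc' uvE].
by have /andP[_ /eqP] := next_cycle cc' xc'; rewrite uvE.
Qed.

Lemma deg_del_edge_other (w : G) : w \notin [set u; v] -> @deg G' w = deg w.
Proof.
rewrite !inE => /norP[wu wv]; congr #|pred_of_set _|; apply/setP=> y.
rewrite !inE /= /del_edge_adj andb_idr // => _.
apply: contraNneq wu => /setP/(_ w).
by rewrite !inE eqxx (negPf wv) orbF => /esym.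
Qed.

Lemma deg_del_edge_end : deg u = (@deg G' u).+1.
Proof.
rewrite /deg (cardsD1 v) inE cycle_edge_adj; congr (_ + #|pred_of_set _|).
apply/setP=> y; rewrite !inE /= /del_edge_adj andbC; congr (_ && ~~ _).
apply/idP/idP => [/eqP-> //|/eqP/setP uyE].
move: (uyE y) (uyE v); rewrite !inE !eqxx !orbT.
by have [-> _|_ /= <- //] := eqVneq y u; rewrite orbb eq_sym.
Qed.

(** The detour to [v] leaves [u] a neighbour after the deletion. So [u] has degree at least 2 in
    [G], and it becomes a leaf exactly when that degree is 2. *)
Lemma pendant_del_edge_end : connected G ->
  u \notin pendants G /\
  (u \in pendants G') = (u \notin cycle_branch c).
Proof.
move=> conG; have uv := cycle_edge_adj; have [uc _] := cycle_edge_mem.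
have : 0 < @deg G' u.
  have /connectP[[|y p] /= + vE] := del_cycle_edge_connect.
    by move: uv; rewrite vE adj_irr.
  by case/andP=> uy _; apply/card_gt0P; exists y; rewrite inE.
by rewrite !inE uc deg_del_edge_end /=; case: (deg _) => [|[|n]].
Qed.

End DeleteCycleEdge.

Theorem corollary3p6 (G : sgraph) (c : seq G) (k l : nat) (u v : G)
  (G_unicyclic : unicyclic G)
  (c_cycle : is_cycle c) (c_length : size c = k)
  (G_pendants : #|pendants G| = l)
  (uv_in_c : [set u; v] \in cycle_edges c) :
  let V := cycle_branch c in
  let G' := del_edge [set u; v] in
  [/\ u \in V /\ v \in V -> meg G' = l,
      (u \in V) (+) (v \in V) -> meg G' = l + 1
    & u \notin V /\ v \notin V -> meg G' = l + 2].
Proof.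
move=> V G'; have [conG [c0 [_ c0_only]]] := G_unicyclic.
have vu_in_c : [set v; u] \in cycle_edges c by rewrite setUC.
have uNv : u != v.
  by apply: contraTneq (cycle_edge_adj c_cycle uv_in_c) => ->; rewrite adj_irr.
have [uP uP'] := pendant_del_edge_end c_cycle uv_in_c conG.
have [vP] := pendant_del_edge_end c_cycle vu_in_c conG.
rewrite setUC => vP'.
(* One formula covers the three cases: each end outside [V] contributes one new leaf. *)
have -> : meg G' = l + ((u \notin V) + (v \notin V)).
  rewrite meg_acyclic; last exact: del_cycle_edge_connected uv_in_c conG.
    (* Once [u] and [v] are split off, the remaining leaves of [G'] are the pendant vertices of [G]:
       neither end is pendant in [G], and all other degrees are unchanged. *)
    rewrite -G_pendants (cardsD1 u (pendants G')) (cardsD1 v (_ :\ u)).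
    rewrite in_setD1 [v == u]eq_sym uNv andTb addnA [RHS]addnC.
    rewrite -uP' -vP'; congr (_ + #|pred_of_set _|).
    apply/setP=> w; rewrite !inE.
    have [->|wv] := eqVneq w v; first by move: vP; rewrite inE => /negPf->.
    have [->|wu] := eqVneq w u; first by move: uP; rewrite inE => /negPf->.
    by rewrite deg_del_edge_other // !inE negb_or wu.
  apply: del_cycle_edge_acyclic uv_in_c _ => c' /c0_only ->.
  by rewrite (c0_only c).
by case: (u \in V); case: (v \in V); split=> // -[]; rewrite ?addn0.
Qed.
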